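(* Let $\Gamma$ be a countable discrete group acting properly by isometries on a finite product of hyperbolic graphs with bounded degrees. Then $\Gamma$ is weakly amenable.
   Context: Graphs are connected and endowed with the combinatorial (shortest path) distance; a product $X_1\times\cdots\times X_N$ of graphs has the combinatorial distance $d(x,y)=\sum_{i=1}^N d(x_i,y_i)$. Hyperbolic means hyperbolic in the sense of Gromov; bounded degree means the vertex degrees are uniformly bounded. For a nonempty set $X$, a function $\phi:X\times X\to\mathbb{C}$ is a Schur multiplier on $X$ if $M_\phi:(T_{x,y})_{x,y}\mapsto(\phi(x,y)T_{x,y})_{x,y}$ defines a bounded operator on $\mathcal{B}(\ell_2(X))$ (with $T_{x,y}=\langle T\delta_y,\delta_x\rangle$), and $\|\phi\|_{cb}=\|M_\phi\|$. A countable discrete group $\Gamma$ is weakly amenable if there exists a sequence of finitely supported functions $\varphi_n:\Gamma\to\mathbb{C}$ converging pointwise to $1$ such that the functions $\tilde{\varphi}_n:\Gamma\times\Gamma\to\mathbb{C}$, $\tilde{\varphi}_n(s,t)=\varphi_n(s^{-1}t)$, are Schur multipliers on $\Gamma$ with $\sup_n\|\tilde{\varphi}_n\|_{cb}<\infty$. *)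

(* Defs.v *)
From HB Require Import structures.
From mathcomp Require Import all_boot all_order all_algebra.
From mathcomp Require Import all_classical all_reals all_analysis.
From mathcomp Require Export complex.

Set Implicit Arguments.
Unset Strict Implicit.
Unset Printing Implicit Defensive.

Import Order.TTheory GRing.Theory Num.Theory.
Import numFieldNormedType.Exports.

Local Open Scope classical_set_scope.
Local Open Scope ring_scope.

(** * Connected graphs and their combinatorial distance *)

(* Simple, undirected; nonempty, as is part of being connected. *)
Record connected_graph := ConnectedGraph {
  vertex :> Type;
  adj : rel vertex;
  adj_sym : symmetric adj;
  adj_irr : irreflexive adj;
  vertex_nonempty : inhabited vertex;
  adj_connected : forall x y : vertex, exists p, path adj x p /\ last x p = y
}.

Definition has_walk (X : connected_graph) (x y : X) (n : nat) : Prop :=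
  exists p, [/\ path (@adj X) x p, last x p = y & size p = n].

Lemma has_walk_ex (X : connected_graph) (x y : X) :
  exists n, `[< has_walk x y n >].
Proof.
have [p [xp py]] := adj_connected x y.
by exists (size p); apply/asboolP; exists p.
Qed.

Definition gdist (X : connected_graph) (x y : X) : nat :=
  ex_minn (has_walk_ex x y).

Definition bounded_degree (X : connected_graph) : Prop :=
  exists D : nat, forall x : X, ([set y | adj x y] #<= `I_D)%card.

Section hyperbolic.
Variables (R : realType) (X : connected_graph).

Definition gromov_product (w x y : X) : R :=
  ((gdist x w)%:R + (gdist y w)%:R - (gdist x y)%:R) / 2.

Definition hyperbolic : Prop :=
  exists delta : R, forall w x y z : X,
    Num.min (gromov_product w x y) (gromov_product w y z) - delta
      <= gromov_product w x z.

End hyperbolic.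

Definition gprod (N : nat) (X : 'I_N -> connected_graph) : Type :=
  forall i : 'I_N, X i.

Definition prod_dist (N : nat) (X : 'I_N -> connected_graph)
    (x y : gprod X) : nat :=
  (\sum_(i < N) gdist (x i) (y i))%N.

(** * Actions on a set with an integer-valued distance *)

Section action.
Variables (G : groupType) (M : Type) (d : M -> M -> nat) (act : G -> M -> M).

Definition group_action : Prop :=
  (forall x, act 1%g x = x) /\
  (forall g h x, act (g * h)%g x = act g (act h x)).

Definition isometric_action : Prop := forall g x y, d (act g x) (act g y) = d x y.

Definition proper_action : Prop := forall (x0 : M) (r : nat),
  let B := [set x | (d x0 x <= r)%N] in
  finite_set [set g | (act g @` B) `&` B !=set0].

End action.

(** * Bounded operators on l2(X) and Schur multipliers *)

Section schur.
Variables (R : realType) (X : choiceType).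
Implicit Types (f : X -> R[i]) (T S : (X -> R[i]) -> X -> R[i]).

Definition l2_sqnorm f : \bar R :=
  (\esum_(x in [set: X]) ((Normc.normc (f x)) ^+ 2)%:E)%E.

Definition l2 : set (X -> R[i]) := [set f | (l2_sqnorm f < +oo)%E].

Definition l2_norm f : R := Num.sqrt (fine (l2_sqnorm f)).

Definition delta_fun (y : X) : X -> R[i] := fun x => (x == y)%:R.

(* An operator on l2 is represented by a map on all functions, whose values
   outside l2 play no role. *)
Definition opnorm T : \bar R :=
  ereal_sup [set (l2_norm (T f))%:E | f in [set f | l2 f /\ l2_norm f <= 1]].

Definition bounded_operator T : Prop :=
  [/\ forall f, l2 f -> l2 (T f),
      forall (a : R[i]) f g, l2 f -> l2 g ->
        T (fun x => a * f x + g x) = (fun x => a * T f x + T g x)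
    & (opnorm T < +oo)%E].

(* <T delta_y, delta_x> : pairing with delta_x is evaluation at x. *)
Definition matrix_coeff T (x y : X) : R[i] := T (delta_fun y) x.

(* S = M_phi T; a bounded operator is determined by its coefficients. *)
Definition schur_image (phi : X -> X -> R[i]) T S : Prop :=
  forall x y, matrix_coeff S x y = phi x y * matrix_coeff T x y.

(* The operator norm of M_phi. *)
Definition cbnorm (phi : X -> X -> R[i]) : \bar R :=
  ereal_sup [set e | exists T S,
    [/\ bounded_operator T, bounded_operator S, schur_image phi T S,
        (opnorm T <= 1)%E & e = opnorm S]].

Definition schur_multiplier (phi : X -> X -> R[i]) : Prop :=
  (forall T, bounded_operator T ->
     exists S, bounded_operator S /\ schur_image phi T S) /\
  (cbnorm phi < +oo)%E.

End schur.

Definition weakly_amenable (R : realType) (G : groupType) : Prop :=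
  exists phi : nat -> G -> R[i],
    [/\ forall n, finite_set [set g | phi n g != 0],
        forall g, (fun n => phi n g : R[i]^o) @ \oo --> (1 : R[i]^o),
        forall n, schur_multiplier (fun s t => phi n (s^-1 * t)%g)
      & (ereal_sup (range (fun n => cbnorm (fun s t => phi n (s^-1 * t)%g)))
           < +oo)%E].

(* Main.v *)
Require Import Defs.
From mathcomp Require Import all_boot all_order all_algebra.
From mathcomp Require Import all_classical all_reals all_analysis.
From mathcomp Require Import zify ring lra.

(** The multipliers are truncations of r ^ d, where d is the distance between
    orbit points and r tends to 1, following Ozawa's proof that hyperbolic
    groups are weakly amenable.

    In one hyperbolic graph, fix a base point o and write |x| for the distance
    from x to o.  Attach to each vertex x and each time k the set of waypoints
    of x at time k: the vertices within distance k of x whose distance to o is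
    at most |x| - k plus a constant, that is, the vertices near the point
    reached after k steps from x towards o.  Hyperbolicity bounds the diameter
    of these sets ([waypoints_diam]).  It also shows that, once k and l are
    balanced so that |x| - k and |y| - l agree up to a parity bit, the
    waypoints of x at time k meet those of y at time l exactly when
    d(x,y) <= k + l ([gdist_hit], [hit_gdist]).  For each n there is exactly
    one balanced pair with k + l = n, so the indicator of d(x,y) <= n is the
    sum, over k + l = n and over the bit, of the indicators [hit]
    ([hit_count]).

    The kernel [hit] depends on x only through the pair formed by |x| - k and
    the waypoint set, and these pairs are distinct for distinct k.  Since
    degrees are bounded, only boundedly many waypoint sets come near a given
    vertex.  Hence the double sums of alpha_k beta_l [hit] are inner products
    of vectors indexed by such pairs, and their Schur norm is at most a
    constant times the product of the l2 norms of alpha and beta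
    ([hit_schur_bound], from the Cauchy-Schwarz criterion
    [schur_bound_factor]).  With alpha_k = beta_k = r ^ k, multiplication by
    1 - r cancels both norms and leaves a bound uniform in r ([factor_bound]).

    In a product of N graphs, the product of these N kernels has a uniformly
    bounded Schur norm.  Expand it into monomials of total degree
    k_1 + l_1 + ... + k_N + l_N and discard those of degree above M.  What
    remains is a function of the total distance d = d_1 + ... + d_N alone:
    its generating polynomial in degrees up to M is that of
    X ^ d (1 + X + ... + X ^ M) ^ N ([radial_symbol_expand]).  It is therefore
    invariant under every isometry of the product, even one that does not
    respect the factors, and it vanishes for d > M.  The discarded part is a
    tail of a convergent series, so it is small for M large in terms of r
    ([radial_schur_bound]), and the symbol tends to 1 pointwise as r tends
    to 1 ([radial_symbol_cvg]).  Isometry of the action turns the symbol into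
    a function of s^-1 t, and properness makes its support finite. *)

Set Implicit Arguments.
Unset Strict Implicit.
Unset Printing Implicit Defensive.

Import Order.TTheory GRing.Theory Num.Theory.
Import numFieldNormedType.Exports.

Local Open Scope classical_set_scope.
Local Open Scope ring_scope.

(** * Square sums of complex numbers *)

Section SquaredModulus.
Variable R : realType.
Implicit Types z w : R[i].

Definition sqmod z : R := Normc.normc z ^+ 2.

Lemma sqmodE z : sqmod z = complex.Re z ^+ 2 + complex.Im z ^+ 2.
Proof. by case: z => a b; rewrite /sqmod /= sqr_sqrtr // addr_ge0 ?sqr_ge0. Qed.

Lemma sqmod_ge0 z : 0 <= sqmod z.
Proof. exact: sqr_ge0. Qed.

Lemma sqmodM z w : sqmod (z * w) = sqmod z * sqmod w.
Proof. by rewrite /sqmod Normc.normcM exprMn. Qed.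

Lemma sqmod_real (a : R) : sqmod a%:C%C = a ^+ 2.
Proof. by rewrite sqmodE /= expr0n addr0. Qed.

Lemma sqmod_eq0 z : sqmod z = 0 -> z = 0.
Proof. by move=> /eqP; rewrite sqrf_eq0 => /eqP /Normc.eq0_normc. Qed.

Lemma sqmod0 : sqmod 0 = 0.
Proof. by rewrite /sqmod Normc.normc0 expr0n. Qed.

(** The weights are chosen by the caller: with p and q the norm bounds of two
    vectors, summing this inequality gives Minkowski's inequality. *)
Lemma sqmodD_weighted (p q : R) z w : 0 < p -> 0 < q ->
  sqmod (z + w) <= (p + q) * (sqmod z / p + sqmod w / q).
Proof.
move=> p0 q0; rewrite !sqmodE.
case: z => a b; case: w => c d /=.
have key x y : (x + y) ^+ 2 <= (p + q) * (x ^+ 2 / p + y ^+ 2 / q).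
  rewrite -subr_ge0.
  have -> : (p + q) * (x ^+ 2 / p + y ^+ 2 / q) - (x + y) ^+ 2 =
            (q * x - p * y) ^+ 2 / (p * q).
    by field; rewrite !gt_eqF.
  by rewrite divr_ge0 ?sqr_ge0 // mulr_ge0 ?ltW.
apply: le_trans (lerD (key a c) (key b d)) _.
rewrite -mulrDr; set u := (X in X <= _); set v := (X in _ <= X).
by have -> : u = v by rewrite /u /v; ring.
Qed.

Lemma cauchy_schwarz_real (J : Type) (s : seq J) (u v : J -> R) :
  (\sum_(j <- s) u j * v j) ^+ 2 <=
    (\sum_(j <- s) u j ^+ 2) * (\sum_(j <- s) v j ^+ 2).
Proof.
elim: s => [|j s IH]; first by rewrite !big_nil expr0n mulr0.
rewrite !big_cons.
set P := \sum_(j <- s) _ in IH *; set A := \sum_(j <- s) _ in IH *.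
set B := \sum_(j <- s) _ in IH *.
have A0 : 0 <= A by apply: sumr_ge0 => i _; exact: sqr_ge0.
have B0 : 0 <= B by apply: sumr_ge0 => i _; exact: sqr_ge0.
set a := u j; set b := v j.
suff : 2 * (a * b * P) <= a ^+ 2 * B + A * b ^+ 2.
  move=> h.
  have -> : (a * b + P) ^+ 2 = a ^+ 2 * b ^+ 2 + 2 * (a * b * P) + P ^+ 2.
    by ring.
  have -> : (a ^+ 2 + A) * (b ^+ 2 + B) =
    a ^+ 2 * b ^+ 2 + (a ^+ 2 * B + A * b ^+ 2) + A * B by ring.
  by rewrite !lerD.
have h0 : 0 <= a ^+ 2 * B + A * b ^+ 2.
  by rewrite addr_ge0 // mulr_ge0 ?sqr_ge0.
apply: le_trans (ler_norm _) _.
rewrite -(@ler_pXn2r _ 2) ?nnegrE //.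
rewrite real_normK ?num_real //.
apply: (@le_trans _ _ (4 * a ^+ 2 * b ^+ 2 * (A * B))).
  have -> : (2 * (a * b * P)) ^+ 2 = 4 * a ^+ 2 * b ^+ 2 * P ^+ 2 by ring.
  by rewrite ler_wpM2l // mulr_ge0 ?sqr_ge0 // mulr_ge0 ?sqr_ge0.
rewrite -subr_ge0.
have -> : (a ^+ 2 * B + A * b ^+ 2) ^+ 2 - 4 * a ^+ 2 * b ^+ 2 * (A * B) =
          (a ^+ 2 * B - A * b ^+ 2) ^+ 2 by ring.
exact: sqr_ge0.
Qed.

Lemma sqmod_sum_le (J : Type) (s : seq J) (u : J -> R) (v : J -> R[i]) :
  sqmod (\sum_(j <- s) (u j)%:C%C * v j) <=
    (\sum_(j <- s) u j ^+ 2) * (\sum_(j <- s) sqmod (v j)).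
Proof.
have -> : \sum_(j <- s) sqmod (v j) =
    \sum_(j <- s) (complex.Re (v j)) ^+ 2 + \sum_(j <- s) (complex.Im (v j)) ^+ 2.
  by rewrite -big_split; apply: eq_bigr => j _; rewrite sqmodE.
rewrite sqmodE mulrDr.
have -> : complex.Re (\sum_(j <- s) (u j)%:C%C * v j) =
    \sum_(j <- s) u j * complex.Re (v j).
  elim: s => [|j s IH]; rewrite ?big_nil // !big_cons -IH.
  by case: (v j) => x y /=; case: (\sum_(i <- s) _) => x' y' /=; ring.
have -> : complex.Im (\sum_(j <- s) (u j)%:C%C * v j) =
    \sum_(j <- s) u j * complex.Im (v j).
  elim: s => [|j s IH]; rewrite ?big_nil // !big_cons -IH.
  by case: (v j) => x y /=; case: (\sum_(i <- s) _) => x' y' /=; ring.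
by apply: lerD; exact: cauchy_schwarz_real.
Qed.

End SquaredModulus.

(** * Bounds on l2 norms *)

Section L2Bounds.
Variables (R : realType) (X : choiceType).
Implicit Types (f g : X -> R[i]) (T S : (X -> R[i]) -> X -> R[i]).

(** Bounds by a real number replace the extended-real norm throughout: they
    record membership in l2 at the same time, and by [l2_boundP] they amount to
    inequalities between finite sums. *)
Definition l2_bound f (c : R) : Prop := (l2_sqnorm f <= (c ^+ 2)%:E)%E.

Lemma l2_boundP f c : l2_bound f c <->
  forall s : seq X, uniq s -> \sum_(x <- s) sqmod (f x) <= c ^+ 2.
Proof.
split=> [fc s us|h].
  rewrite -lee_fin; apply: le_trans fc.
  apply: esum_ge; exists [set` s].
    by split => //; exact: finite_seq.
  by rewrite -fsbig_seq // -sumEFin.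
apply: ub_ereal_sup => _ [A [finA _] <-].
rewrite fsbig_finite //= sumEFin lee_fin; apply: h.
exact: finmap.fset_uniq.
Qed.

Lemma l2_sqnorm_ge0 f : (0 <= l2_sqnorm f)%E.
Proof. by apply: esum_ge0 => x _; rewrite lee_fin sqr_ge0. Qed.

Lemma l2_bound_l2 f c : l2_bound f c -> l2 f.
Proof. by move=> fc; apply: le_lt_trans fc _; rewrite ltry. Qed.

Lemma l2_norm_ge0 f : 0 <= l2_norm f.
Proof. exact: sqrtr_ge0. Qed.

Lemma l2_sqnormE f : l2 f -> l2_sqnorm f = (l2_norm f ^+ 2)%:E.
Proof.
move=> fl; rewrite /l2_norm sqr_sqrtr ?fine_ge0 ?l2_sqnorm_ge0 // fineK //.
by rewrite ge0_fin_numE ?l2_sqnorm_ge0.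
Qed.

Lemma l2_bound_norm f : l2 f -> l2_bound f (l2_norm f).
Proof. by move=> fl; rewrite /l2_bound l2_sqnormE. Qed.

Lemma l2_boundE f c : 0 <= c -> l2_bound f c <-> l2 f /\ l2_norm f <= c.
Proof.
move=> c0; split=> [fc|[fl fc]].
  have fl := l2_bound_l2 fc; split => //.
  move: fc; rewrite /l2_bound l2_sqnormE // lee_fin ler_pXn2r // nnegrE //.
  exact: l2_norm_ge0.
rewrite /l2_bound l2_sqnormE // lee_fin ler_pXn2r // nnegrE //.
exact: l2_norm_ge0.
Qed.

Lemma l2_bound_le f c d : 0 <= c -> c <= d -> l2_bound f c -> l2_bound f d.
Proof.
move=> c0 cd fc; apply: le_trans fc _; rewrite lee_fin ler_pXn2r // nnegrE //.
exact: le_trans cd.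
Qed.

Lemma l2_bound_pt f c x : l2_bound f c -> sqmod (f x) <= c ^+ 2.
Proof. by move/l2_boundP => /(_ [:: x] isT); rewrite big_seq1. Qed.

Lemma l2_bound0 f : l2_bound f 0 -> f = (fun=> 0).
Proof.
move=> fc; apply/funext => x; apply: sqmod_eq0; apply/le_anti.
by rewrite sqmod_ge0 andbT; have := l2_bound_pt x fc; rewrite expr0n.
Qed.

Lemma l2_bound_zero c : l2_bound (fun=> 0) c.
Proof.
by apply/l2_boundP => s _; rewrite big1 ?sqr_ge0 // => x _; rewrite sqmod0.
Qed.

Lemma l2_boundD f g c d : 0 <= c -> 0 <= d ->
  l2_bound f c -> l2_bound g d -> l2_bound (fun x => f x + g x) (c + d).
Proof.
move=> c0 d0.
have [->|cn0] := eqVneq c 0.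
  move=> /l2_bound0 -> gd; rewrite add0r.
  by congr l2_bound: gd; apply/funext => x; rewrite add0r.
have [->|dn0] := eqVneq d 0.
  move=> fc /l2_bound0 ->; rewrite addr0.
  by congr l2_bound: fc; apply/funext => x; rewrite addr0.
have cp : 0 < c by rewrite lt_def cn0.
have dp : 0 < d by rewrite lt_def dn0.
move=> /l2_boundP fc /l2_boundP gd; apply/l2_boundP => s us.
apply: (@le_trans _ _
  (\sum_(x <- s) (c + d) * (sqmod (f x) / c + sqmod (g x) / d))).
  by apply: ler_sum => x _; exact: sqmodD_weighted.
rewrite -mulr_sumr big_split /= -!mulr_suml expr2 ler_wpM2l ?addr_ge0 //.
by apply: lerD; rewrite ler_pdivrMr // -expr2; [exact: fc|exact: gd].
Qed.

Lemma l2_boundZ (a : R[i]) f c : l2_bound f c ->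
  l2_bound (fun x => a * f x) (Normc.normc a * c).
Proof.
move=> /l2_boundP fc; apply/l2_boundP => s us.
rewrite exprMn -/(sqmod a) (eq_bigr (fun x => sqmod a * sqmod (f x))).
  by rewrite -mulr_sumr ler_wpM2l ?sqmod_ge0 // fc.
by move=> x _; rewrite sqmodM.
Qed.

Lemma normc_ge0 (a : R[i]) : 0 <= Normc.normc a.
Proof. by case: a => a b; exact: sqrtr_ge0. Qed.

Lemma normc_real (a : R) : Normc.normc a%:C%C = `|a|.
Proof. by rewrite /= expr0n addr0 sqrtr_sqr. Qed.

Lemma l2_comb (a : R[i]) f g : l2 f -> l2 g -> l2 (fun x => a * f x + g x).
Proof.
move=> fl gl; apply: l2_bound_l2 (l2_boundD _ _ (l2_boundZ a (l2_bound_norm fl))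
  (l2_bound_norm gl)); last exact: l2_norm_ge0.
by rewrite mulr_ge0 ?l2_norm_ge0 ?normc_ge0.
Qed.

Lemma l2_zero : l2 ((fun=> 0) : X -> R[i]).
Proof. exact: l2_bound_l2 (l2_bound_zero 0). Qed.

Lemma l2_mult (b : X -> R) f c : (forall x, b x ^+ 2 <= c) -> l2 f ->
  l2 (fun x => (b x)%:C%C * f x).
Proof.
move=> bc /l2_bound_norm /l2_boundP fl.
have [c0|c0] := ltP c 0.
  apply: l2_bound_l2 (_ : l2_bound _ 0); apply/l2_boundP => s us.
  rewrite big1 ?sqr_ge0 // => x _.
  by have := le_lt_trans (bc x) c0; rewrite ltNge sqr_ge0.
apply: l2_bound_l2 (_ : l2_bound _ (Num.sqrt c * l2_norm f)).
apply/l2_boundP => s us.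
rewrite exprMn sqr_sqrtr //.
apply: le_trans (_ : \sum_(x <- s) c * sqmod (f x) <= _).
  apply: ler_sum => x _; rewrite sqmodM sqmod_real.
  by rewrite ler_wpM2r ?sqmod_ge0.
by rewrite -mulr_sumr ler_wpM2l // fl.
Qed.

Lemma l2_bound_delta (y : X) : l2_bound (delta_fun R y) 1.
Proof.
apply/l2_boundP => s us; rewrite expr1n.
have h x : sqmod (delta_fun R y x) = (x == y)%:R :> R.
  rewrite /delta_fun; case: (x == y); last exact: sqmod0.
  by rewrite /sqmod Normc.normc1 expr1n.
under eq_bigr do rewrite h.
rewrite -natr_sum -[1]/(1%:R) ler_nat.
rewrite -big_mkcond sum1_count.
rewrite (@eq_count _ _ (pred1 y)) // count_uniq_mem //; exact: leq_b1.
Qed.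

Lemma l2_delta (y : X) : l2 (delta_fun R y).
Proof. exact: l2_bound_l2 (l2_bound_delta y). Qed.

End L2Bounds.

(** * Bounded operators *)

Section Operators.
Variables (R : realType) (X : choiceType).
Implicit Types (f g : X -> R[i]) (T S : (X -> R[i]) -> X -> R[i]).

Definition l2_linear (T : (X -> R[i]) -> X -> R[i]) : Prop :=
  forall (a : R[i]) (f g : X -> R[i]), l2 f -> l2 g ->
    T (fun x => a * f x + g x) = (fun x => a * T f x + T g x).

(** The operator bound is required at every radius c, which spares the
    renormalization of vectors; [op_boundP] compares it with [opnorm]. *)
Definition op_bound T (t : R) : Prop :=
  forall (f : X -> R[i]) c, 0 <= c -> l2_bound f c -> l2_bound (T f) (t * c).

Lemma l2_linear0 T : l2_linear T -> T (fun=> 0) = (fun=> 0).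
Proof.
move=> lT; have := lT (-1) _ _ (l2_zero R X) (l2_zero R X).
have -> : (fun x : X => -1 * (fun=> 0 : R[i]) x + (fun=> 0) x) = (fun=> 0).
  by apply/funext => x; rewrite mulr0 addr0.
move=> ->; apply/funext => x; ring.
Qed.

Lemma l2_linearZ T a f : l2_linear T -> l2 f ->
  T (fun x => a * f x) = (fun x => a * T f x).
Proof.
move=> lT fl; have := lT a _ _ fl (l2_zero R X).
have -> : (fun x => a * f x + (fun=> 0) x) = (fun x => a * f x).
  by apply/funext => x; rewrite addr0.
by move=> ->; apply/funext => x; rewrite l2_linear0 // addr0.
Qed.

Lemma op_boundP T t : l2_linear T -> 0 <= t ->
  op_bound T t <->
  (forall f, l2 f -> l2 (T f)) /\ (opnorm T <= t%:E)%E.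
Proof.
move=> lT t0; split=> [bT|[Tl2 Tt]].
  split=> [f fl|].
    by apply: l2_bound_l2 (bT _ _ (l2_norm_ge0 f) (l2_bound_norm fl)).
  apply: ub_ereal_sup => _ [f [fl f1] <-]; rewrite lee_fin.
  have : l2_bound f 1 by apply/l2_boundE.
  by move=> /(bT _ _ ler01); rewrite mulr1 => /l2_boundE [].
move=> f c c0; have [->|cn0] := eqVneq c 0.
  by move=> /l2_bound0 ->; rewrite l2_linear0 //; exact: l2_bound_zero.
have cp : 0 < c by rewrite lt_def cn0.
move=> fc; have fl := l2_bound_l2 fc.
pose g x := (c^-1)%:C%C * f x.
have g1 : l2_bound g 1.
  have := l2_boundZ (c^-1)%:C%C fc.
  by rewrite normc_real ger0_norm ?invr_ge0 // mulVf.
have gl := l2_bound_l2 g1.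
have Tgt : l2_bound (T g) t.
  apply/l2_boundE => //; split; first exact: Tl2.
  rewrite -lee_fin; apply: le_trans Tt; apply: ereal_sup_ubound.
  by exists g => //; apply/l2_boundE.
have -> : T f = (fun x => c%:C%C * T g x).
  rewrite -l2_linearZ //; congr T; apply/funext => x.
  by rewrite /g mulrA -rmorphM /= mulfV // rmorph1 mul1r.
by have := l2_boundZ c%:C%C Tgt; rewrite normc_real ger0_norm // mulrC.
Qed.

Lemma opnorm_ge0 T : l2_linear T -> (0 <= opnorm T)%E.
Proof.
move=> lT; apply: ereal_sup_ubound.
exists (fun=> 0); first by apply/l2_boundE => //; exact: l2_bound_zero.
rewrite l2_linear0 //.
have /l2_boundE -/(_ (lexx _)) [_ h] := l2_bound_zero X (0 : R).
by congr EFin; apply/le_anti; rewrite h l2_norm_ge0.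
Qed.

Lemma bounded_operatorP T : bounded_operator T <->
  l2_linear T /\ exists2 t, 0 <= t & op_bound T t.
Proof.
split=> [[Tl lT nT]|[lT [t t0 bT]]].
  split => //.
  have fin : opnorm T \is a fin_num.
    by rewrite ge0_fin_numE // opnorm_ge0.
  exists (fine (opnorm T)); first by rewrite fine_ge0 // opnorm_ge0.
  by apply/op_boundP => //; rewrite ?fine_ge0 ?opnorm_ge0 // fineK.
have [Tl nT] := (op_boundP lT t0).1 bT.
by split => //; apply: le_lt_trans nT _; rewrite ltry.
Qed.

(** Linearity gives the vanishing on finitely supported vectors; these are dense
    in l2, so the bound on T gives it everywhere. *)
Lemma op_bound_ext_zero T t : l2_linear T -> 0 <= t -> op_bound T t ->
  (forall x y, matrix_coeff T x y = 0) -> forall f, l2 f -> T f = (fun=> 0).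
Proof.
move=> lT t0 bT T0 f fl; apply/funext => x; apply: sqmod_eq0.
apply/le_anti; rewrite sqmod_ge0 andbT; apply/ler_addgt0Pl => e e0.
rewrite addr0.
have kill (s : seq X) : uniq s ->
    T (fun x => if x \in s then f x else 0) = (fun=> 0) /\
    l2 (fun x => if x \in s then f x else 0).
  elim: s => [_|y s IH /= /andP[ys us]].
    by split; [rewrite l2_linear0|exact: l2_zero].
  have [Ts ls] := IH us.
  have -> : (fun x => if x \in y :: s then f x else 0) =
      (fun x => f y * delta_fun R y x + (if x \in s then f x else 0)).
    apply/funext => z; rewrite in_cons /delta_fun.
    by have [->|] := eqVneq z y;
      rewrite ?(negbTE ys) /= ?mulr1 ?mulr0 ?addr0 ?add0r.
  split; last by apply: l2_comb => //; exact: l2_delta.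
  rewrite lT //; last exact: l2_delta.
  by apply/funext => z; rewrite Ts -/(matrix_coeff T z y) T0 mulr0 addr0.
(* The tolerance d on the squared norm of the tail of f is such that
   t ^+ 2 * d <= e, also when t = 0. *)
have t1 : 0 < t ^+ 2 + 1 by rewrite ltr_wpDl ?sqr_ge0.
pose d := e / (t ^+ 2 + 1).
have d0 : 0 < d by rewrite divr_gt0.
have [s us hs] : exists2 s : seq X, uniq s &
    l2_norm f ^+ 2 - d < \sum_(x <- s) sqmod (f x).
  have : ((l2_norm f ^+ 2 - d)%:E < l2_sqnorm f)%E.
    by rewrite l2_sqnormE // lte_fin ltrBlDr ltrDl.
  move=> /ereal_sup_gt[_ [A [finA _] <-]].
  rewrite fsbig_finite //= sumEFin lte_fin => h.
  by exists (finmap.enum_fset (fset_set A)) => //; exact: finmap.fset_uniq.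
have [Tfs ls] := kill s us.
pose g x := if x \in s then 0 else f x.
have gE : g = (fun x => -1 * (if x \in s then f x else 0) + f x).
  by apply/funext => z; rewrite /g; case: (z \in s); ring.
have Tg : T f = T g.
  by rewrite gE lT // Tfs; apply/funext => z; rewrite mulr0 add0r.
have gd : l2_bound g (Num.sqrt d).
  apply/l2_boundP => s' us'; rewrite sqr_sqrtr ?ltW //.
  have us2 : uniq (s ++ [seq x <- s' | x \notin s]).
    rewrite cat_uniq us filter_uniq // andbT /=.
    by apply/hasPn => z; rewrite mem_filter => /andP[].
  have /l2_boundP /(_ _ us2) := l2_bound_norm fl.
  rewrite big_cat /= big_filter.
  have -> : \sum_(x <- s') sqmod (g x) =
      \sum_(x <- s' | x \notin s) sqmod (f x).
    rewrite [RHS]big_mkcond; apply: eq_bigr => z _; rewrite /g.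
    by case: (z \in s) => //=; rewrite sqmod0.
  move: hs; set p := \sum_(x <- s) _; set q := \sum_(x <- s' | _) _.
  lra.
rewrite Tg.
have := l2_bound_pt x (bT _ _ (sqrtr_ge0 _) gd).
rewrite exprMn sqr_sqrtr; last exact: ltW.
move=> h; apply: le_trans h _.
rewrite /d mulrA ler_pdivrMr // mulrC ler_wpM2l //; first exact: ltW.
by rewrite lerDl.
Qed.

(** The norm in [cbnorm] is that of an arbitrary operator with the prescribed
    coefficients; this lemma identifies it with the one that a construction
    provides. *)
Lemma eq_matrix_coeff T S : bounded_operator T -> bounded_operator S ->
  (forall x y, matrix_coeff T x y = matrix_coeff S x y) ->
  forall f, l2 f -> T f = S f.
Proof.
move=> /bounded_operatorP[lT [t t0 bT]] /bounded_operatorP[lS [s s0 bS]] TS f fl.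
pose D g := (fun x => -1 * S g x + T g x).
have lD : l2_linear D.
  by move=> a g h gl hl; rewrite /D lT // lS //; apply/funext => x; ring.
have bD : op_bound D (s + t).
  move=> g c c0 gc; rewrite mulrDl; apply: l2_boundD; rewrite ?mulr_ge0 //.
    have := l2_boundZ (-1) (bS _ _ c0 gc).
    have -> : Normc.normc (-1 : R[i]) = 1.
      by rewrite -[_ (-1)]/(Normc.normc (- 1)) normcN Normc.normc1.
    by rewrite mul1r.
  exact: bT.
have := op_bound_ext_zero lD (addr_ge0 s0 t0) bD _ fl.
move=> h; have {}h := h _; apply/funext => x.
have /(congr1 (@^~ x)) : D f = (fun=> 0).
  by apply: h => y z; rewrite /matrix_coeff /D -!/(matrix_coeff _ _ _) TS; ring.
rewrite /D => /eqP; rewrite mulN1r addrC subr_eq0 => /eqP; exact.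
Qed.

End Operators.

(** * Bounds on Schur multipliers *)

Section SchurBounds.
Variables (R : realType) (X : choiceType).
Implicit Types (phi psi : X -> X -> R) (T S : (X -> R[i]) -> X -> R[i]).

(** The bound C is a bound on the map T |-> S, in the form that composes: it
    yields the norm estimate of [cbnorm] and the existence of the multiplied
    operator at once ([schur_bound_cbnorm]). *)
Definition schur_bound phi (C : R) : Prop :=
  forall T (t : R), 0 <= t -> l2_linear T -> op_bound T t ->
  exists S, [/\ l2_linear S, op_bound S (C * t)
              & schur_image (fun x y => (phi x y)%:C%C) T S].

Lemma schur_bound_le phi C D : 0 <= C -> C <= D ->
  schur_bound phi C -> schur_bound phi D.
Proof.
move=> C0 CD phiC T t t0 lT bT; have [S [lS bS imS]] := phiC T t t0 lT bT.
exists S; split => // f c c0 fc; apply: l2_bound_le (bS f c c0 fc).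
  by rewrite !mulr_ge0.
by rewrite -!mulrA ler_wpM2r // mulr_ge0.
Qed.

Lemma schur_bound1 : schur_bound (fun _ _ => 1) 1.
Proof.
move=> T t t0 lT bT; exists T; split => // [|x y]; first by rewrite mul1r.
by rewrite rmorph1 mul1r.
Qed.

Lemma schur_bound0 : schur_bound (fun _ _ => 0) 0.
Proof.
move=> T t t0 lT bT; exists (fun _ _ => 0); split => //.
- by move=> a f g _ _; apply/funext => x; rewrite mulr0 addr0.
- by move=> f c _ _; exact: l2_bound_zero.
by move=> x y; rewrite rmorph0 mul0r.
Qed.

(** Pointwise products of symbols are compositions of multipliers. *)
Lemma schur_boundM phi psi C D : 0 <= C ->
  schur_bound phi C -> schur_bound psi D ->
  schur_bound (fun x y => phi x y * psi x y) (D * C).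
Proof.
move=> C0 phiC psiD T t t0 lT bT.
have [S [lS bS imS]] := phiC T t t0 lT bT.
have [U [lU bU imU]] := psiD S (C * t) (mulr_ge0 C0 t0) lS bS.
exists U; split => //; first by rewrite -mulrA.
by move=> x y; rewrite imU imS rmorphM /= mulrA [X in X * _]mulrC.
Qed.

Lemma schur_boundD phi psi C D : 0 <= C -> 0 <= D ->
  schur_bound phi C -> schur_bound psi D ->
  schur_bound (fun x y => phi x y + psi x y) (C + D).
Proof.
move=> C0 D0 phiC psiD T t t0 lT bT.
have [S [lS bS imS]] := phiC T t t0 lT bT.
have [U [lU bU imU]] := psiD T t t0 lT bT.
exists (fun f x => S f x + U f x); split.
- by move=> a f g fl gl; rewrite lS // lU //; apply/funext => x; ring.
- move=> f c c0 fc; rewrite mulrDl mulrDl.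
  by apply: l2_boundD; rewrite ?mulr_ge0 //; [exact: bS|exact: bU].
by move=> x y; rewrite [LHS](congr2 +%R (imS x y) (imU x y)) rmorphD /= mulrDl.
Qed.

Lemma schur_boundZ (a : R) phi C : schur_bound phi C ->
  schur_bound (fun x y => a * phi x y) (`|a| * C).
Proof.
move=> phiC T t t0 lT bT.
have [S [lS bS imS]] := phiC T t t0 lT bT.
exists (fun f x => a%:C%C * S f x); split.
- by move=> b f g fl gl; rewrite lS //; apply/funext => x; ring.
- move=> f c c0 fc; have := l2_boundZ a%:C%C (bS f c c0 fc).
  by rewrite normc_real !mulrA.
by move=> x y; rewrite /matrix_coeff -/(matrix_coeff S x y) imS rmorphM /= mulrA.
Qed.

Lemma schur_bound_sum (J : Type) (s : seq J) (P : pred J)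
    (phi : J -> X -> X -> R) (C : J -> R) :
  (forall j, P j -> 0 <= C j) -> (forall j, P j -> schur_bound (phi j) (C j)) ->
  schur_bound (fun x y => \sum_(j <- s | P j) phi j x y) (\sum_(j <- s | P j) C j).
Proof.
move=> C0 phiC; elim: s => [|j s IH].
  rewrite big_nil; under eq_fun do under eq_fun do rewrite big_nil.
  exact: schur_bound0.
rewrite big_cons; under eq_fun do under eq_fun do rewrite big_cons.
case: ifP => // Pj; apply: schur_boundD => //; [exact: C0 | | exact: phiC].
exact: sumr_ge0.
Qed.

Lemma schur_bound_prod (J : Type) (s : seq J)
    (phi : J -> X -> X -> R) (C : J -> R) :
  (forall j, 0 <= C j) -> (forall j, schur_bound (phi j) (C j)) ->
  schur_bound (fun x y => \prod_(j <- s) phi j x y) (\prod_(j <- s) C j).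
Proof.
move=> C0 phiC; elim: s => [|j s IH].
  rewrite big_nil; under eq_fun do under eq_fun do rewrite big_nil.
  exact: schur_bound1.
rewrite big_cons mulrC; under eq_fun do under eq_fun do rewrite big_cons.
by apply: schur_boundM.
Qed.

Lemma schur_bound_cbnorm phi C : 0 <= C -> schur_bound phi C ->
  schur_multiplier (fun x y => (phi x y)%:C%C) /\
  (cbnorm (fun x y => (phi x y)%:C%C) <= C%:E)%E.
Proof.
move=> C0 phiC.
have cbC : (cbnorm (fun x y => (phi x y)%:C%C) <= C%:E)%E.
  apply: ub_ereal_sup => _ [T [S [bT bS imS nT ->]]].
  have [lT _] := (bounded_operatorP T).1 bT.
  have bT1 : op_bound T 1.
    by apply/op_boundP => //; split => //; case: bT.
  have [U [lU bU imU]] := phiC T 1 ler01 lT bT1.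
  have bdU : bounded_operator U.
    by apply/bounded_operatorP; split => //; exists (C * 1) => //; rewrite mulr1.
  apply: ub_ereal_sup => _ [f [fl f1] <-]; rewrite lee_fin.
  have -> : S f = U f by apply: eq_matrix_coeff => // x y; rewrite imS imU.
  have : l2_bound f 1 by apply/l2_boundE.
  by move/(bU f 1 ler01); rewrite !mulr1 => /(l2_boundE _ C0)[].
split=> //; split; last by apply: le_lt_trans cbC _; rewrite ltry.
move=> T /bounded_operatorP[lT [t t0 bT]].
have [S [lS bS imS]] := phiC T t t0 lT bT.
exists S; split => //; apply/bounded_operatorP; split => //.
by exists (C * t) => //; rewrite mulr_ge0.
Qed.

(** The elementary half of Grothendieck's characterization of Schur multipliers:
    the symbol is the inner product of the vectors a(x), which carries al j at
    the index u x j, and b(y).  The multiplied operator is the sum over i of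
    a_i(x) T(b_i f)(x); by Cauchy-Schwarz its value at x is at most A times the
    l2 norm in i of T(b_i f)(x), and summing over x first leaves the sum of
    the square norms of b_i f.  Injectivity of u x makes the norm of a(x)
    that of al. *)
Lemma schur_bound_factor (I : choiceType) (J : finType) (u : X -> J -> I)
    (al : J -> R) (b : I -> X -> R) (A B : R) : 0 <= A -> 0 <= B ->
  (forall x, injective (u x)) ->
  \sum_j al j ^+ 2 <= A ^+ 2 ->
  (forall y (s : seq I), uniq s -> \sum_(i <- s) b i y ^+ 2 <= B ^+ 2) ->
  schur_bound (fun x y => \sum_j al j * b (u x j) y) (A * B).
Proof.
move=> A0 B0 uinj alA bB T t t0 lT bT.
pose m i (f : X -> R[i]) := fun y => (b i y)%:C%C * f y.
have bB1 i y : b i y ^+ 2 <= B ^+ 2.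
  by have := bB y [:: i] isT; rewrite big_seq1.
have ml2 i f : l2 f -> l2 (m i f) by apply: l2_mult => y; exact: bB1.
exists (fun f x => \sum_j (al j)%:C%C * T (m (u x j) f) x); split.
- move=> a f g fl gl; apply/funext => x.
  rewrite mulr_sumr -big_split; apply: eq_bigr => j _ /=.
  have -> : m (u x j) (fun z => a * f z + g z) =
      (fun z => a * m (u x j) f z + m (u x j) g z).
    by apply/funext => z; rewrite /m; ring.
  by rewrite lT; [ring|exact: ml2|exact: ml2].
- move=> f c c0 fc; have fl := l2_bound_l2 fc.
  apply/l2_boundP => s us.
  (* The rows in s involve only these finitely many indices. *)
  pose Is := undup (flatten [seq [seq u x j | j <- enum J] | x <- s]).
  have uIs : uniq Is := undup_uniq _.
  have inI x j : x \in s -> u x j \in Is.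
    move=> xs; rewrite mem_undup; apply/flattenP.
    exists [seq u x j | j <- enum J]; first exact: (map_f (fun x => _)).
    by apply: map_f; rewrite mem_enum.
  have row x : x \in s -> sqmod (\sum_j (al j)%:C%C * T (m (u x j) f) x) <=
      A ^+ 2 * \sum_(i <- Is) sqmod (T (m i f) x).
    move=> xs; apply: le_trans (sqmod_sum_le _ _ _) _.
    apply: ler_pM => //; try by apply: sumr_ge0 => j _; rewrite ?sqr_ge0 ?sqmod_ge0.
    rewrite -(big_map (u x) xpredT (fun i => sqmod (T (m i f) x))).
    have ux : uniq [seq u x j | j <- index_enum J].
      by rewrite map_inj_uniq ?index_enum_uniq.
    have sub : {subset [seq u x j | j <- index_enum J] <= Is}.
      by move=> _ /mapP[j _ ->]; exact: inI.
    set w := [seq u x j | j <- index_enum J] in ux sub *.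
    rewrite [leRHS](bigID (mem w)) /=.
    have -> : \sum_(i <- Is | i \in w) sqmod (T (m i f) x) =
              \sum_(i <- w) sqmod (T (m i f) x).
      rewrite -big_filter; apply: perm_big; apply: uniq_perm => //.
        exact: filter_uniq.
      move=> i; rewrite mem_filter; case: (boolP (i \in w)) => //= /sub.
      by [].
    by rewrite lerDl sumr_ge0 // => i _; exact: sqmod_ge0.
  apply: le_trans (_ : \sum_(x <- s) A ^+ 2 * \sum_(i <- Is) sqmod (T (m i f) x)
     <= _).
    by rewrite big_seq [leRHS]big_seq; apply: ler_sum => x xs; exact: row.
  rewrite -mulr_sumr exchange_big /=.
  apply: le_trans (_ : A ^+ 2 * \sum_(i <- Is) t ^+ 2 * l2_norm (m i f) ^+ 2 <= _).
    rewrite ler_wpM2l ?sqr_ge0 //; apply: ler_sum => i _.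
    have /l2_boundP := bT _ _ (l2_norm_ge0 _) (l2_bound_norm (ml2 i f fl)).
    by move=> /(_ s us); rewrite exprMn.
  rewrite -mulr_sumr.
  have -> : (A * B * t * c) ^+ 2 = A ^+ 2 * (t ^+ 2 * (B ^+ 2 * c ^+ 2)) by ring.
  do 2 (apply: ler_wpM2l; first exact: sqr_ge0).
  rewrite -lee_fin -sumEFin.
  rewrite (eq_bigr (fun i => l2_sqnorm (m i f))); last first.
    by move=> i _; rewrite l2_sqnormE //; exact: ml2.
  rewrite /l2_sqnorm -esum_sum; last by move=> *; rewrite lee_fin sqr_ge0.
  apply: ub_ereal_sup => _ [F [finF _] <-].
  rewrite fsbig_finite //=.
  under eq_bigr do rewrite sumEFin.
  rewrite sumEFin lee_fin.
  have uF : uniq (finmap.enum_fset (fset_set F)) by exact: finmap.fset_uniq.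
  set F' := finmap.enum_fset _ in uF *.
  apply: le_trans (_ : \sum_(y <- F') B ^+ 2 * sqmod (f y) <= _).
    apply: ler_sum => y _.
    rewrite (eq_bigr (fun i => b i y ^+ 2 * sqmod (f y))); last first.
      by move=> i _; rewrite -/(sqmod _) sqmodM sqmod_real.
    by rewrite -mulr_suml ler_wpM2r ?sqmod_ge0 // bB.
  rewrite -mulr_sumr ler_wpM2l ?sqr_ge0 //.
  by move/l2_boundP: fc; apply.
move=> x y; rewrite /matrix_coeff rmorph_sum mulr_suml; apply: eq_bigr => j _.
have -> : m (u x j) (delta_fun R y) =
    (fun z => (b (u x j) y)%:C%C * delta_fun R y z).
  apply/funext => z; rewrite /m /delta_fun.
  by have [->|] := eqVneq z y; rewrite ?mulr0.
rewrite l2_linearZ //; last exact: l2_delta.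
by rewrite rmorphM /= mulrA.
Qed.

End SchurBounds.

(** * The combinatorial distance *)

Section GraphMetric.
Variable X : connected_graph.
Implicit Types x y z w : X.

Lemma gdist_walk x y : has_walk x y (gdist x y).
Proof. by rewrite /gdist; case: ex_minnP => n /asboolP. Qed.

Lemma gdist_le x y n : has_walk x y n -> (gdist x y <= n)%N.
Proof.
by move=> h; rewrite /gdist; case: ex_minnP => m _; apply; apply/asboolP.
Qed.

Lemma gdistxx x : gdist x x = 0%N.
Proof. by apply/eqP; rewrite -leqn0; apply: gdist_le; exists [::]. Qed.

Lemma gdist_eq0 x y : gdist x y = 0%N -> x = y.
Proof.
by move=> h; have [p []] := gdist_walk x y; rewrite h => _ <- /size0nil ->.
Qed.

Lemma has_walk_sym x y n : has_walk x y n -> has_walk y x n.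
Proof.
move=> [p [xp <- <-]]; exists (rev (belast x p)); split.
- by rewrite rev_path; apply: sub_path xp => a b; rewrite adj_sym.
- by case: p {xp} => [//|z p] /=; rewrite rev_cons last_rcons.
by rewrite size_rev size_belast.
Qed.

Lemma gdistC x y : gdist x y = gdist y x.
Proof.
by apply/eqP; rewrite eqn_leq; apply/andP; split; apply: gdist_le;
  apply: has_walk_sym; exact: gdist_walk.
Qed.

Lemma gdist_triangle y x z : (gdist x z <= gdist x y + gdist y z)%N.
Proof.
have [p [xp py sp]] := gdist_walk x y; have [q [yq qz sq]] := gdist_walk y z.
apply: gdist_le; exists (p ++ q); split.
- by rewrite cat_path xp py.
- by rewrite last_cat py.
by rewrite size_cat sp sq.
Qed.

Lemma gdist_intermediate x y m : (m <= gdist x y)%N ->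
  exists w, gdist x w = m /\ (gdist w y + m = gdist x y)%N.
Proof.
move=> mxy; have [p [xp py sp]] := gdist_walk x y.
pose w := last x (take m p).
have h1 : (gdist x w <= m)%N.
  apply: gdist_le; exists (take m p); split => //.
    by move: xp; rewrite -{1}(cat_take_drop m p) cat_path => /andP[].
  by rewrite size_takel // sp.
have h2 : (gdist w y <= gdist x y - m)%N.
  apply: gdist_le; exists (drop m p); split.
  - by move: xp; rewrite -{1}(cat_take_drop m p) cat_path => /andP[].
  - by rewrite -py -{2}(cat_take_drop m p) last_cat.
  by rewrite size_drop sp.
by exists w; have := gdist_triangle w x y; lia.
Qed.

Lemma gdist_adj x y n : gdist x y = n.+1 ->
  exists2 z, gdist x z = n & adj z y.
Proof.
move=> h; have [z [xz zy]] : exists w, gdist x w = n /\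
    (gdist w y + n = gdist x y)%N by apply: gdist_intermediate; rewrite h.
exists z => //; have [p [zp py sp]] := gdist_walk z y.
have {}sp : size p = 1%N by lia.
by case: p zp py sp => [//|a [|//]] /=; rewrite andbT => ? <-.
Qed.

(** The finite type does not depend on the centre, so its cardinal bounds the
    size of all balls of radius n. *)
Lemma bounded_degree_ball : bounded_degree X -> forall n,
  exists F : finType, forall x, exists e : F -> X,
    forall y, (gdist x y <= n)%N -> exists i, e i = y.
Proof.
move=> [D degD]; elim=> [|n [F ballF]].
  exists unit => x; exists (fun=> x) => y; rewrite leqn0 => /eqP /gdist_eq0 ->.
  by exists tt.
exists (F * option 'I_D)%type => x; have [e eP] := ballF x.
have nbr z : exists f : 'I_D -> X, forall y, adj z y -> exists i, f i = y.
  have /pcard_leP[f] := degD z.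
  have /choice[g gP] : forall i : 'I_D, exists v, forall y, adj z y -> f y = i ->
      v = y.
    move=> i; have [[v [zv fv]]|no] := pselect (exists v, adj z v /\ f v = i).
      exists v => y zy fy; apply: (@inj _ _ _ f); [exact/mem_set|exact/mem_set|].
      exact: etrans fv (esym fy).
    by exists z => y zy fy; case: no; exists y.
  exists g => y zy.
  have fy : (f y < D)%N by apply: (@funS _ _ _ _ f).
  by exists (Ordinal fy); exact: gP.
have /choice[f fP] : forall i, exists f : 'I_D -> X,
    forall y, adj (e i) y -> exists j, f j = y by move=> i; exact: nbr.
exists (fun p => if p.2 is Some j then f p.1 j else e p.1) => y.
rewrite leq_eqVlt => /orP[/eqP /gdist_adj[z xz zy]|].
  have [i iz] : exists i, e i = z by apply: eP; rewrite xz.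
  have [j jy] : exists j, f i j = y by apply: fP; rewrite iz.
  by exists (i, Some j).
by rewrite ltnS => /eP[i iy]; exists (i, None).
Qed.

(** Uniform in x as well: sets of vertices inside a ball of radius n are counted
    by the subsets of one finite type. *)
Lemma bounded_degree_subsets : bounded_degree X -> forall n,
  exists F : finType, forall x, exists e : F -> set X,
    forall A : set X, (forall y, A y -> (gdist x y <= n)%N) -> exists i, e i = A.
Proof.
move=> degX n; have [F ballF] := bounded_degree_ball degX n.
exists {set F} => x; have [e eP] := ballF x.
exists (fun S : {set F} => [set e i | i in [set` S]]) => A An.
exists [set i | `[< A (e i) >]]%SET; apply/seteqP; split => [_ [i /= + <-]|y Ay].
  by rewrite inE => /asboolP.
have [i iy] := eP y (An y Ay); exists i => //=.
by rewrite inE; apply/asboolP; rewrite iy.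
Qed.

(** Gromov's inequality between products, doubled and cleared of the
    subtractions, so that it can be used in integer arithmetic. *)
Definition four_point (J : nat) : Prop := forall w x y z,
  (gdist x z + gdist y w <= gdist x y + gdist z w + J)%N \/
  (gdist x z + gdist y w <= gdist y z + gdist x w + J)%N.

Lemma hyperbolic_four_point (R : realType) : hyperbolic R X ->
  exists J, four_point J.
Proof.
move=> [delta hyp].
have [J dJ] : exists J : nat, 2 * delta <= J%:R :> R.
  exists (Num.bound `|2 * delta|); apply: le_trans (ler_norm _) _.
  exact/ltW/archi_boundP/normr_ge0.
exists J => w x y z; have := hyp w x y z; rewrite /gromov_product.
rewrite lerBlDr ge_min => /orP[h|h]; [left|right];
  rewrite -(ler_nat R) !natrD; move: h dJ; lra.
Qed.

End GraphMetric.

(** * Waypoints in a hyperbolic graph *)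

Section Confluence.
Variables (X : connected_graph) (o : X) (J : nat).
Hypothesis fourX : four_point X J.
Implicit Types x y z w : X.

(** The subtraction is truncated: past the time |x| the waypoints stay near o,
    as if every path went on along a ray attached to o.  The slack 3 * J + 2
    is what the two cases of [gdist_hit] require. *)
Definition waypoints (k : nat) x : set X :=
  [set w | gdist x w <= k /\ gdist w o <= gdist x o - k + (3 * J + 2)]%N.

(** For k <= |x| both points have Gromov product with x, seen from o, at least
    |x| - k; so does, up to J / 2, the product of one with the other, while their
    distances to o exceed |x| - k by a constant at most.  For k > |x| both are
    near o. *)
Lemma waypoints_diam k x w w' : waypoints k x w -> waypoints k x w' ->
  (gdist w w' <= 7 * J + 4)%N.
Proof.
move=> [xw wo] [xw' wo'].
have := fourX o w x w'; have := gdist_triangle w x o.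
have := gdist_triangle w' x o; have := gdist_triangle o w w'.
rewrite (gdistC w x) (gdistC o w'); lia.
Qed.

(** The equation says |x| - k = |y| - l + e without subtraction.  For a given sum
    k + l its two sides differ by an integer of fixed parity, hence the bit. *)
Definition hit (e : bool) (k l : nat) x y : bool :=
  (gdist x o + l == gdist y o + k + e)%N &&
  `[< waypoints k x `&` waypoints l y !=set0 >].

Lemma hit_gdist e k l x y : hit e k l x y -> (gdist x y <= k + l)%N.
Proof.
move=> /andP[_ /asboolP[w [[xw _] [yw _]]]].
have := gdist_triangle w x y; rewrite (gdistC w y); lia.
Qed.

(** If k >= |x| then l >= |y| and o is a common waypoint.  Otherwise put
    h = |x| - k and let t be the Gromov product of x and y seen from o.  When
    t >= h + J, paths from x and from y to o are still close at height h + J, and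
    the point at time k - J on a geodesic from x to o works: stopping J steps early
    absorbs the error in the distance to y.  When t < h + J, the hypothesis
    d(x,y) <= k + l keeps t close to h, and the point at time k on a geodesic
    from x to y works. *)
Lemma gdist_hit (e : bool) k l x y : (gdist x o + l = gdist y o + k + e)%N ->
  (gdist x y <= k + l)%N -> hit e k l x y.
Proof.
move=> hgt xykl; rewrite /hit hgt eqxx /=; apply/asboolP.
have e1 : (e <= 1)%N by case: (e).
move: (nat_of_bool e) e1 hgt => {}e e1 hgt.
have [xk|kx] := leqP (gdist x o) k.
  by exists o; rewrite /waypoints /= gdistxx; lia.
have [far|near] :=
    leqP (gdist x y + 2 * (gdist x o - k + J)) (gdist x o + gdist y o).
  have Jk : (J <= k)%N.
    by have := gdist_triangle x o y; rewrite (gdistC o y) (gdistC o x); lia.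
  have [w [xw wo]] : exists w, gdist x w = (k - J)%N /\
      (gdist w o + (k - J) = gdist x o)%N by apply: gdist_intermediate; lia.
  exists w; rewrite /waypoints /=.
  have := fourX o y x w; rewrite (gdistC y x) (gdistC y w); lia.
have [w [xw wy]] : exists w, gdist x w = minn k (gdist x y) /\
    (gdist w y + minn k (gdist x y) = gdist x y)%N.
  by apply: gdist_intermediate; exact: geq_minr.
exists w; rewrite /waypoints /=.
have := fourX o x w y; rewrite (gdistC y w); lia.
Qed.

(** The equation in [hit] and k + l = n force 2 k + e = |x| + n - |y|, so k and e
    are the quotient and the remainder of that number by 2. *)
Lemma hit_count M n x y : (n <= M)%N ->
  (\sum_(j : 'I_M.+1 * 'I_M.+1 * bool | (j.1.1 + j.1.2 == n :> nat)%N)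
     hit j.2 j.1.1 j.1.2 x y)%N = (gdist x y <= n)%N.
Proof.
move=> nM; have [xyn|nxy] := leqP (gdist x y) n; last first.
  rewrite big1 // => j /eqP jn; apply/eqP; rewrite eqb0; apply/negP => /hit_gdist.
  by rewrite jn leqNgt nxy.
have t1 := gdist_triangle x y o; have t2 := gdist_triangle y x o.
rewrite (gdistC y x) in t1.
pose q := (gdist x o + n - gdist y o)%N.
have qE := odd_double_half q; rewrite -addnn in qE.
have q1 : (odd q <= 1)%N by case: odd.
have kM : (q./2 < M.+1)%N by lia.
have lM : (n - q./2 < M.+1)%N by lia.
rewrite (bigD1 (Ordinal kM, Ordinal lM, odd q)) /=; last by apply/eqP; lia.
rewrite gdist_hit ?big1 //=; try lia.
move=> [[k l] e] /= /andP[/eqP kln]; apply: contraNeq; rewrite eqb0 negbK.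
move=> /andP[/eqP hE _].
have e1 : (e <= 1)%N by case: (e).
have qq : (q = e + (k + k))%N by lia.
have eo : e = odd q by rewrite qq addnn oddD odd_double addbF; case: (e).
have kq : k = q./2 :> nat by rewrite -eo in qE; lia.
rewrite eo; apply/eqP; congr (_, _, _); apply/val_inj => //=; lia.
Qed.

End Confluence.

(** * The Schur norm of the meeting kernel *)

Section HitSchur.
Variables (R : realType) (X : connected_graph) (o : X) (J : nat).
Hypothesis fourX : four_point X J.
Hypothesis degX : bounded_degree X.

(** The index attached to x at time k is its height |x| - k, an integer of either
    sign, together with its waypoint set.  Distinct times have distinct heights,
    which gives the injectivity needed for [schur_bound_factor].  On the side
    of y the height determines l, and the waypoint set has to meet that of y: as
    both have bounded diameter, it lies in a ball of fixed radius. *)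
Lemma hit_schur_bound : exists2 K : R, 0 <= K &
  forall (P : choiceType) (pos : P -> X) (e : bool) (m : nat)
    (al be : 'I_m -> R) (A B : R), 0 <= A -> 0 <= B ->
    \sum_k al k ^+ 2 <= A ^+ 2 -> \sum_l be l ^+ 2 <= B ^+ 2 ->
  schur_bound (fun s t => \sum_(k < m) \sum_(l < m)
    al k * be l * (hit o J e k l (pos s) (pos t))%:R) (A * (K * B)).
Proof.
pose L := (7 * J + 4)%N.
have [F subF] := bounded_degree_subsets degX (L + L).
pose K : R := (#|F|.+1)%:R.
have K1 : 1 <= K by rewrite ler1n.
have K0 : 0 <= K by exact: le_trans K1.
exists K => // P pos e m al be A B A0 B0 alA beB.
pose small (S : set X) := forall w w', S w -> S w' -> (gdist w w' <= L)%N.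
(* Only sets of small diameter are allowed as indices; otherwise infinitely
   many of them could meet the waypoints of y. *)
pose ind (l : 'I_m) (i : int * set X) y : bool :=
  `[< [/\ i.1 = (gdist y o)%:Z - (l : nat)%:Z + (e : nat)%:Z :> int, small i.2
        & i.2 `&` waypoints o J l y !=set0] >].
pose b (i : int * set X) (t : P) : R := \sum_(l < m) be l * (ind l i (pos t))%:R.
pose u (s : P) (k : 'I_m) : int * set X :=
  ((gdist (pos s) o)%:Z - (k : nat)%:Z, waypoints o J k (pos s)).
have phiE (s t : P) : \sum_(k < m) \sum_(l < m)
    al k * be l * (hit o J e k l (pos s) (pos t))%:R = \sum_k al k * b (u s k) t.
  apply: eq_bigr => k _; rewrite mulr_sumr; apply: eq_bigr => l _.
  rewrite mulrA; congr (_ * (nat_of_bool _)%:R).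
  apply/idP/asboolP => [/andP[/eqP h1 /asboolP h2]|[/= h1 _ h2]].
    split => //=; first lia.
    by move=> w w'; exact: waypoints_diam.
  by rewrite /hit; apply/andP; split; [apply/eqP; lia|exact/asboolP].
under eq_fun do under eq_fun do rewrite phiE.
apply: schur_bound_factor => //; first by rewrite mulr_ge0.
  by move=> s k k' [h _]; apply/val_inj => /=; lia.
move=> t s us; rewrite exprMn.
have sq i : b i t ^+ 2 = \sum_(l < m) be l ^+ 2 * (ind l i (pos t))%:R.
  have [[l il]|no] := pselect (exists l, ind l i (pos t)); last first.
    rewrite /b !big1 ?expr0n // => l _;
      by case: (boolP (ind l i _)) => [il|_]; [case: no; exists l|rewrite mulr0].
  have other l' : l' != l -> ind l' i (pos t) = false.
    apply: contraNF => /asboolP[h1 _ _]; move/asboolP: il => [h2 _ _].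
    by apply/eqP/val_inj => /=; lia.
  rewrite /b (bigD1 l) //= big1 => [|l' /other ->]; last by rewrite mulr0.
  rewrite (bigD1 l) //= big1 => [|l' /other ->]; last by rewrite mulr0.
  by rewrite il !mulr1 !addr0.
under eq_bigr do rewrite sq.
rewrite exchange_big /=.
apply: le_trans (_ : \sum_(l < m) be l ^+ 2 * K ^+ 2 <= _); last first.
  by rewrite -mulr_suml mulrC ler_wpM2l ?sqr_ge0.
apply: ler_sum => l _; rewrite -mulr_sumr ler_wpM2l ?sqr_ge0 //.
apply: le_trans (_ : K <= _); last by rewrite expr2 ler_peMl.
rewrite -natr_sum ler_nat.
have -> : (\sum_(i <- s) ind l i (pos t) = size [seq i <- s | ind l i (pos t)])%N.
  by rewrite -big_mkcond sum1_count size_filter.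
have [[w0 wl]|no] := pselect (waypoints o J l (pos t) !=set0); last first.
  rewrite size_filter (@eq_count _ _ pred0) ?count_pred0 // => i.
  by apply: asboolF => -[_ _ [w [_ wl]]]; apply: no; exists w.
have [f fP] := subF w0.
pose h := (gdist (pos t) o)%:Z - (l : nat)%:Z + (e : nat)%:Z : int.
apply: leqW; rewrite cardE -(size_map (fun j => (h, f j))).
apply: uniq_leq_size; first exact: filter_uniq.
move=> [h' S]; rewrite mem_filter => /andP[/asboolP[/= hE Ssm [w [Sw wl']]] _].
have [j jS] : exists j, f j = S.
  apply: fP => y Sy; apply: leq_trans (gdist_triangle w _ _) _.
  by apply: leq_add; [have := waypoints_diam fourX wl wl'; exact|exact: Ssm].
by apply/mapP; exists j; rewrite ?mem_enum // jS hE.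
Qed.

End HitSchur.

(** * The truncated radial symbol *)

Section RadialSymbol.
Variable R : realType.
Implicit Types (r s : R) (N M D : nat).

Definition geom_poly M : {poly R} := \poly_(j < M.+1) 1.

(** Up to truncation, X ^ D times the N-th power of the geometric series is
    X ^ D / (1 - X) ^ N, and the prefactor (1 - r) ^ N turns its value at r into
    r ^ D. *)
Definition radial_symbol N r M D : R :=
  (1 - r) ^+ N * \sum_(n < M.+1) r ^+ n * ('X^D * geom_poly M ^+ N)`_n.

Lemma radial_symbol_eq0 N r M D : (M < D)%N -> radial_symbol N r M D = 0.
Proof.
move=> MD; rewrite /radial_symbol big1 ?mulr0 // => n _.
by rewrite coefXnM (leq_trans (ltn_ord n) MD) mulr0.
Qed.

Lemma geom_poly_horner r M : (1 - r) * (geom_poly M).[r] = 1 - r ^+ M.+1.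
Proof.
rewrite horner_poly -opprB -[1 - _]opprB subrX1 mulNr; congr (- (_ * _)).
by apply: eq_bigr => i _; rewrite mul1r.
Qed.

Lemma geom_sum_le r M : 0 <= r -> r < 1 -> \sum_(k < M) r ^+ k <= (1 - r)^-1.
Proof.
move=> r0 r1; have r1' : 0 < 1 - r by rewrite subr_gt0.
rewrite -[leRHS]mul1r ler_pdivlMr // mulrC -opprB mulNr -subrX1 opprB.
by rewrite gerBl exprn_ge0.
Qed.

Lemma geom_poly_horner_le r M : 0 <= r -> r < 1 ->
  (geom_poly M).[r] <= (1 - r)^-1.
Proof.
move=> r0 r1; rewrite horner_poly.
by under eq_bigr do rewrite mul1r; exact: geom_sum_le.
Qed.

Definition coef_ge0 (p : {poly R}) := forall n, 0 <= p`_n.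

Lemma coef_ge0M p q : coef_ge0 p -> coef_ge0 q -> coef_ge0 (p * q).
Proof.
by move=> p0 q0 n; rewrite coefM sumr_ge0 // => i _; exact: mulr_ge0.
Qed.

Lemma coef_ge0X p n : coef_ge0 p -> coef_ge0 (p ^+ n).
Proof.
move=> p0; elim: n => [|n IH]; last by rewrite exprS; exact: coef_ge0M.
by move=> k; rewrite expr0 coefC; case: eqP.
Qed.

(** The untruncated polynomial has value r ^ D (1 - r ^ M.+1) ^ N at r.  In the
    degrees n > M that the symbol omits, r ^ n = s ^ (2 n) <= s ^ M * s ^ n, and
    the coefficients are nonnegative, so the omitted part is at most s ^ M times
    the value at s. *)
Lemma radial_symbol_approx N s M D : 0 <= s -> s < 1 ->
  `|radial_symbol N (s ^+ 2) M D - (s ^+ 2) ^+ D * (1 - (s ^+ 2) ^+ M.+1) ^+ N|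
    <= s ^+ M * ((1 - s)^-1) ^+ N.
Proof.
move=> s0 s1; set r := s ^+ 2.
have r0 : 0 <= r by exact: sqr_ge0.
have r1 : r < 1 by rewrite expr_lt1.
have r1' : 0 <= 1 - r <= 1 by apply/andP; split; lra.
pose p : {poly R} := 'X^D * geom_poly M ^+ N.
have p0 : coef_ge0 p.
  apply: coef_ge0M; first by move=> n; rewrite coefXn; case: eqP.
  by apply: coef_ge0X => n; rewrite coef_poly; case: ifP.
have size_p : (size p <= M.+1 + size p)%N by rewrite leq_addl.
have pE x : p.[x] = x ^+ D * (geom_poly M).[x] ^+ N.
  by rewrite /p hornerM hornerXn horner_exp.
have -> : r ^+ D * (1 - r ^+ M.+1) ^+ N = (1 - r) ^+ N * p.[r].
  by rewrite pE mulrCA -exprMn geom_poly_horner.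
rewrite /radial_symbol -/p -mulrBr normrM ger0_norm ?exprn_ge0 //; last first.
  by case/andP: r1'.
rewrite (horner_coef_wide r size_p) big_split_ord /= distrC.
have -> : \sum_(n < M.+1) r ^+ n * p`_n = \sum_(n < M.+1) p`_n * r ^+ n.
  by apply: eq_bigr => n _; rewrite mulrC.
rewrite addrAC subrr add0r ger0_norm; last first.
  by apply: sumr_ge0 => i _; rewrite mulr_ge0 ?exprn_ge0.
apply: le_trans (_ : \sum_(i < size p) p`_(M.+1 + i) * r ^+ (M.+1 + i) <= _).
  rewrite ler_piMl //; last by rewrite exprn_ile1 //; case/andP: r1'.
  by apply: sumr_ge0 => i _; rewrite mulr_ge0 ?exprn_ge0.
apply: le_trans (_ : s ^+ M * p.[s] <= _); last first.
  rewrite ler_wpM2l ?exprn_ge0 // pE.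
  have E0 : 0 <= (geom_poly M).[s].
    by rewrite horner_poly sumr_ge0 // => i _; rewrite mul1r exprn_ge0.
  apply: le_trans (_ : (geom_poly M).[s] ^+ N <= _).
    by apply: ler_piMl; [exact: exprn_ge0 | exact: exprn_ile1 (ltW s1)].
  apply: lerXn2r; rewrite ?nnegrE ?invr_ge0 ?subr_ge0 ?geom_poly_horner_le //.
  exact: ltW.
rewrite (horner_coef_wide s size_p) big_split_ord /= mulrDr.
apply: ler_wpDl.
  by rewrite mulr_ge0 ?exprn_ge0 ?sumr_ge0 // => i _; rewrite mulr_ge0 ?exprn_ge0.
rewrite mulr_sumr; apply: ler_sum => i _; rewrite mulrCA ler_wpM2l //.
rewrite -exprM -exprD; apply: ler_wiXn2l => //; [exact: ltW|lia].
Qed.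

Lemma coef_prod_congr (I : Type) (t : seq I) (p q : I -> {poly R}) M :
  (forall i n, (n <= M)%N -> (p i)`_n = (q i)`_n) ->
  forall n, (n <= M)%N -> (\prod_(i <- t) p i)`_n = (\prod_(i <- t) q i)`_n.
Proof.
move=> pq; elim: t => [|i t IH] n nM; first by rewrite !big_nil.
rewrite !big_cons !coefM; apply: eq_bigr => j _.
have jn : (j <= n)%N by rewrite -ltnS.
by rewrite pq ?IH //; [apply: leq_trans (leq_subr _ _) nM|apply: leq_trans jn nM].
Qed.

End RadialSymbol.

(** * Radial kernels on a product *)

Section ProductKernel.
Variables (R : realType) (P : choiceType) (N : nat).
(** The factors enter only through the count of [hits_count] and the norm estimate
    of [hits_bound]; the kernels live on the set P that indexes the orbit, so that
    no function has to be pulled back from the factors afterwards. *)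
Variables (hits : 'I_N -> bool -> nat -> nat -> P -> P -> bool).
Variables (d : 'I_N -> P -> P -> nat) (K : 'I_N -> R).
Hypothesis K_ge0 : forall i, 0 <= K i.
Hypothesis hits_count : forall i M n g h, (n <= M)%N ->
  (\sum_(j : 'I_M.+1 * 'I_M.+1 * bool | (j.1.1 + j.1.2 == n :> nat)%N)
     hits i j.2 j.1.1 j.1.2 g h)%N = (d i g h <= n)%N.
Hypothesis hits_bound : forall i e m (al be : 'I_m -> R) (A B : R),
  0 <= A -> 0 <= B ->
  \sum_k al k ^+ 2 <= A ^+ 2 -> \sum_l be l ^+ 2 <= B ^+ 2 ->
  schur_bound (fun g h => \sum_(k < m) \sum_(l < m)
    al k * be l * (hits i e k l g h)%:R) (A * (K i * B)).

Section Truncation.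
Variable M : nat.
Notation Idx := ('I_M.+1 * 'I_M.+1 * bool)%type.
Implicit Types (f : {ffun 'I_N -> Idx}) (j : Idx).

Let wt j : nat := (j.1.1 + j.1.2)%N.
Let deg f : nat := (\sum_i wt (f i))%N.
Let chi i j (g h : P) : R := (hits i j.2 j.1.1 j.1.2 g h)%:R.

Lemma hits_poly_coef i g h n : (n <= M)%N ->
  (\sum_j chi i j g h *: 'X^(wt j))`_n = ('X^(d i g h) * geom_poly R M)`_n.
Proof.
move=> nM; rewrite coef_sum coefXnM coef_poly.
under eq_bigr do rewrite coefZ coefXn eq_sym.
transitivity ((d i g h <= n)%N%:R : R).
  rewrite -(hits_count i g h nM) natr_sum [RHS]big_mkcond; apply: eq_bigr => j _.
  by rewrite -/(wt j); case: eqP => _; rewrite ?mulr1 ?mulr0.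
by rewrite ltnS (leq_trans (leq_subr _ _) nM); case: leqP.
Qed.

(** Both sides compare coefficients of the product over i of the polynomials of
    [hits_poly_coef], which agree with X ^ (d i g h) times a geometric series in
    degrees at most M; higher degrees cannot contribute to degrees at most M of
    a product. *)
Lemma radial_symbol_expand r g h :
  radial_symbol N r M (\sum_i d i g h) =
  \sum_(f : {ffun 'I_N -> Idx} | (deg f <= M)%N)
    \prod_i ((1 - r) * (r ^+ wt (f i) * chi i (f i) g h)).
Proof.
pose G i := \sum_j chi i j g h *: 'X^(wt j) : {poly R}.
have GE : \prod_i G i =
    \sum_(f : {ffun 'I_N -> Idx}) (\prod_i chi i (f i) g h) *: 'X^(deg f).
  rewrite /G bigA_distr_bigA; apply: eq_bigr => f _.
  rewrite (eq_bigr (fun i => (chi i (f i) g h)%:P * 'X^(wt (f i)))); last first.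
    by move=> i _; rewrite mul_polyC.
  by rewrite big_split /= -rmorph_prod mul_polyC prodrXr.
rewrite /radial_symbol.
rewrite (eq_bigr (fun n : 'I_M.+1 => \sum_f
    (r ^+ deg f * \prod_i chi i (f i) g h) * (deg f == n)%:R)); last first.
  move=> n _.
  have -> : 'X^(\sum_i d i g h) * geom_poly R M ^+ N =
            \prod_(i < N) ('X^(d i g h) * geom_poly R M).
    by rewrite big_split /= prodrXr prodr_const card_ord.
  rewrite -(coef_prod_congr _ (fun i n => @hits_poly_coef i g h n)); last first.
    by rewrite -ltnS.
  rewrite GE coef_sum mulr_sumr; apply: eq_bigr => f _.
  rewrite coefZ coefXn eq_sym.
  by case: eqP => [->|_]; rewrite ?mulr1 ?mulr0.
rewrite exchange_big /= mulr_sumr [RHS]big_mkcond; apply: eq_bigr => f _ /=.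
rewrite -mulr_sumr.
have -> : \sum_(n < M.+1) (deg f == n)%:R = ((deg f <= M)%N)%:R :> R.
  case: leqP => h'.
    have h1 : (deg f < M.+1)%N by [].
    rewrite (bigD1 (Ordinal h1)) //= eqxx big1 ?addr0 // => n.
    by rewrite -val_eqE /= eq_sym => /negbTE ->.
  rewrite big1 // => n _; case: eqP => // e.
  by move: h'; rewrite e ltnNge -ltnS ltn_ord.
case: ifP => _; last by rewrite !mulr0.
by rewrite mulr1 !big_split /= prodr_const card_ord prodrXr.
Qed.

(** The l2 norms of the two geometric sequences multiply to at most 1 / (1 - r),
    which the prefactor cancels; the factor 2 counts the parity bit. *)
Lemma factor_bound i r : 0 <= r -> r < 1 ->
  schur_bound (fun g h => \sum_j (1 - r) * (r ^+ wt j * chi i j g h)) (K i *+ 2).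
Proof.
move=> r0 r1; have r1' : 0 < 1 - r by rewrite subr_gt0.
pose q := Num.sqrt (1 - r)^-1.
have q0 : 0 <= q by exact: sqrtr_ge0.
have qq : q ^+ 2 = (1 - r)^-1 by rewrite sqr_sqrtr // invr_ge0 ltW.
have geom2 : \sum_(k < M.+1) (r ^+ k) ^+ 2 <= q ^+ 2.
  rewrite qq; apply: le_trans (geom_sum_le M.+1 r0 r1).
  apply: ler_sum => k _; rewrite -exprM; apply: ler_wiXn2l => //; [exact: ltW|lia].
have half e : schur_bound (fun g h => (1 - r) * \sum_(k < M.+1) \sum_(l < M.+1)
    r ^+ k * r ^+ l * (hits i e k l g h)%:R) (K i).
  have := schur_boundZ (1 - r) (hits_bound i e q0 q0 geom2 geom2).
  rewrite gtr0_norm //.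
  have -> : (1 - r) * (q * (K i * q)) = K i * ((1 - r) * q ^+ 2) by ring.
  by rewrite qq mulfV ?mulr1 // gt_eqF.
have := schur_boundD (K_ge0 i) (K_ge0 i) (half true) (half false).
rewrite -mulr2n; congr schur_bound.
apply/funext => g; apply/funext => h.
rewrite -mulr_sumr -mulrDr; congr (_ * _).
rewrite -(pair_bigA _ (fun p e => r ^+ wt (p, e) * chi i (p, e) g h)) /=.
rewrite -(pair_bigA _
  (fun k l => \sum_e r ^+ wt (k, l, e) * chi i (k, l, e) g h)) /=.
rewrite -big_split; apply: eq_bigr => k _ /=.
rewrite -big_split; apply: eq_bigr => l _ /=.
by rewrite big_bool /= /wt /chi /= exprD.
Qed.

Lemma hits_bound1 i j : schur_bound (chi i j) (K i).
Proof.
case: j => [[k0 l0] e].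
have one (k1 : 'I_M.+1) : \sum_k ((k == k1)%:R : R) ^+ 2 <= 1 ^+ 2.
  rewrite (bigD1 k1) //= eqxx big1 ?addr0 // => k /negbTE ->.
  by rewrite expr0n.
have := hits_bound i e ler01 ler01 (one k0) (one l0).
rewrite mulr1 mul1r; congr schur_bound.
apply/funext => g; apply/funext => h.
rewrite (bigD1 k0) //= [X in _ + X]big1 ?addr0; last first.
  by move=> k /negbTE ->; rewrite big1 // => l _; rewrite !mul0r.
rewrite (bigD1 l0) //= [X in _ + X]big1 ?addr0; first by rewrite !eqxx !mul1r.
by move=> l /negbTE ->; rewrite mulr0 mul0r.
Qed.

(** The truncated kernel is the full product of the factors minus the terms of
    degree above M.  The latter are bounded term by term: s ^ M gains over the
    sum of all s ^ deg f, because r = s ^+ 2. *)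
Lemma radial_schur_bound s : 0 <= s -> s < 1 ->
  schur_bound (fun g h => radial_symbol N (s ^+ 2) M (\sum_i d i g h))
    (\prod_i (K i *+ 2) + \prod_i K i * (s ^+ M * (2 / (1 - s) ^+ 2) ^+ N)).
Proof.
move=> s0 s1; set r := s ^+ 2.
have r0 : 0 <= r by exact: sqr_ge0.
have r1 : r < 1 by rewrite expr_lt1.
have r1' : 0 <= 1 - r <= 1 by apply/andP; split; lra.
have PK0 : 0 <= \prod_i K i by exact: prodr_ge0.
pose w i j (g h : P) := (1 - r) * (r ^+ wt j * chi i j g h).
have wK i j : schur_bound (w i j) (r ^+ wt j * K i).
  have h := schur_boundZ (1 - r) (schur_boundZ (r ^+ wt j) (hits_bound1 i j)).
  apply: schur_bound_le h; rewrite ?mulr_ge0 ?normr_ge0 //.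
  rewrite !ger0_norm ?exprn_ge0 //; last by case/andP: r1'.
  rewrite ler_piMl ?mulr_ge0 ?exprn_ge0 //; by case/andP: r1'.
have boxB : schur_bound (fun g h => \prod_i \sum_j w i j g h) (\prod_i (K i *+ 2)).
  apply: schur_bound_prod => i; first by rewrite mulrn_wge0.
  exact: factor_bound.
pose tail := \sum_(f : {ffun 'I_N -> Idx} | ~~ (deg f <= M)%N)
  \prod_i (r ^+ wt (f i) * K i).
have tailB : schur_bound
    (fun g h => \sum_(f : {ffun 'I_N -> Idx} | ~~ (deg f <= M)%N)
      \prod_i w i (f i) g h) tail.
  apply: schur_bound_sum => f _.
    by apply: prodr_ge0 => i _; rewrite mulr_ge0 ?exprn_ge0.
  by apply: schur_bound_prod => i //; rewrite mulr_ge0 ?exprn_ge0.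
have tail0 : 0 <= tail.
  by apply: sumr_ge0 => f _; apply: prodr_ge0 => i _; rewrite mulr_ge0 ?exprn_ge0.
have box0 : 0 <= \prod_i (K i *+ 2).
  by apply: prodr_ge0 => i _; rewrite mulrn_wge0.
have := schur_boundD box0 (mulr_ge0 (normr_ge0 (-1 : R)) tail0) boxB
          (schur_boundZ (-1) tailB).
rewrite normrN1 mul1r => bound.
have -> : (fun g h => radial_symbol N r M (\sum_i d i g h)) =
    (fun g h => \prod_i \sum_j w i j g h +
      -1 * \sum_(f : {ffun 'I_N -> Idx} | ~~ (deg f <= M)%N) \prod_i w i (f i) g h).
  apply/funext => g; apply/funext => h; rewrite radial_symbol_expand.
  rewrite bigA_distr_bigA.
  rewrite [X in _ = X + _](bigID (fun f : {ffun 'I_N -> Idx} => (deg f <= M)%N)).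
  by rewrite /= mulN1r addrK.
apply: schur_bound_le bound; first exact: addr_ge0.
rewrite lerD2l.
apply: le_trans (_ : \prod_i K i *
    \sum_(f : {ffun 'I_N -> Idx}) s ^+ M * s ^+ deg f <= _).
  rewrite mulr_sumr [leRHS](bigID (fun f : {ffun 'I_N -> Idx} => (deg f <= M)%N)) /=.
  apply: ler_wpDl.
    by apply: sumr_ge0 => f _; rewrite !mulr_ge0 ?exprn_ge0.
  apply: ler_sum => f; rewrite -ltnNge => Mf.
  rewrite big_split /= mulrC ler_wpM2l // prodrXr -/(deg f) -exprM -exprD.
  by apply: ler_wiXn2l => //; [exact: ltW|lia].
rewrite ler_wpM2l // -mulr_sumr ler_wpM2l ?exprn_ge0 //.
have -> : \sum_(f : {ffun 'I_N -> Idx}) s ^+ deg f =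
    \prod_(i < N) \sum_(j : Idx) s ^+ wt j.
  by rewrite bigA_distr_bigA; apply: eq_bigr => f _; rewrite prodrXr.
rewrite prodr_const card_ord.
have geo : \sum_(j : Idx) s ^+ wt j = 2 * (\sum_(k < M.+1) s ^+ k) ^+ 2.
  rewrite -(pair_bigA _ (fun p e => s ^+ wt (p, e))) /=.
  rewrite -(pair_bigA _ (fun k l => \sum_(e : bool) s ^+ wt (k, l, e))) /=.
  rewrite expr2 mulr_suml mulr_sumr; apply: eq_bigr => k _.
  rewrite mulr_sumr mulr_sumr; apply: eq_bigr => l _.
  by rewrite big_bool /wt /= exprD; ring.
have S0 : 0 <= \sum_(k < M.+1) s ^+ k.
  by apply: sumr_ge0 => k _; rewrite exprn_ge0.
have s1' : 0 <= (1 - s)^-1 by rewrite invr_ge0 subr_ge0 ltW.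
rewrite geo; apply: lerXn2r; rewrite ?nnegrE ?mulr_ge0 ?exprn_ge0 //.
  by rewrite invr_ge0 exprn_ge0 // subr_ge0 ltW.
rewrite ler_wpM2l // -exprVn; apply: lerXn2r; rewrite ?nnegrE //.
exact: geom_sum_le.
Qed.

End Truncation.
End ProductKernel.

(** * The limit and the theorem *)

Section Limit.
Variable R : realType.

(** Take s_j tending to 1 and then M_j so large that every error term, including
    the one of [radial_schur_bound], is at most 1 / (j + 1). *)
Lemma radial_symbol_cvg (N : nat) : exists (s : nat -> R) (M : nat -> nat),
  (forall j, [/\ 0 <= s j, s j < 1 &
     s j ^+ M j * (2 / (1 - s j) ^+ 2) ^+ N <= 1]) /\
  forall D, radial_symbol N (s j ^+ 2) (M j) D @[j --> \oo] --> (1 : R).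
Proof.
pose s j : R := 1 - harmonic j.+1.
have har j : 0 < harmonic j.+1 :> R by rewrite /harmonic /= invr_gt0.
have har1 j : harmonic j.+1 < 1 :> R.
  by rewrite /harmonic /= invf_lt1 // ltr1n.
have s0 j : 0 <= s j by rewrite subr_ge0 ltW.
have s1 j : s j < 1 by rewrite /s ltrBlDr ltrDl.
have ratio_ge1 j : 1 <= 2 / (1 - s j) ^+ 2.
  have y0 : 0 < 1 - s j by rewrite subr_gt0.
  rewrite ler_pdivlMr ?exprn_gt0 // mul1r.
  apply: le_trans (_ : 1 <= _); last by lra.
  by rewrite exprn_ile1 /s; have := har1 j; have := har j; lra.
have /choice[M MP] : forall j, exists M,
    s j ^+ M * (2 / (1 - s j) ^+ 2) ^+ N <= harmonic j.
  move=> j; set c := (2 / (1 - s j) ^+ 2) ^+ N.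
  have c0 : 0 < c by rewrite exprn_gt0 // (lt_le_trans ltr01).
  have := @cvg_expr R (s j); rewrite ger0_norm // => /(_ (s1 j)).
  move=> /cvgrPdist_lt /(_ (harmonic j / c)).
  have h0 : 0 < harmonic j / c :> R by rewrite divr_gt0 // /harmonic /= invr_gt0.
  move=> /(_ h0) [M _ /(_ M (leqnn M))] /=.
  rewrite sub0r normrN ger0_norm ?exprn_ge0 // ltr_pdivlMr // => /ltW ?.
  by exists M.
have M1 j : s j ^+ M j * ((1 - s j)^-1) ^+ N <= harmonic j.
  apply: le_trans (MP j); rewrite ler_wpM2l ?exprn_ge0 //.
  have y0 : 0 < 1 - s j by rewrite subr_gt0.
  apply: lerXn2r; rewrite ?nnegrE ?invr_ge0 ?divr_ge0 ?exprn_ge0 // ?(ltW y0) //.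
  rewrite ler_pdivlMr ?exprn_gt0 // expr2 mulrA mulVf ?mul1r ?gt_eqF //.
  by have := s0 j; lra.
have M0 j : s j ^+ M j <= harmonic j.
  apply: le_trans (MP j); rewrite ler_peMr ?exprn_ge0 //.
  exact: exprn_ege1.
exists s, M; split.
  move=> j; split => //; apply: le_trans (MP j) _.
  by rewrite /harmonic /= invf_le1 // ler1n.
move=> D.
have s_cvg : s j @[j --> \oo] --> (1 : R).
  rewrite -[1]subr0; apply: cvgB; first exact: cvg_cst.
  by rewrite (cvg_shiftS (harmonic : nat -> R^o)); exact: cvg_harmonic.
have pow_cvg (u : nat -> R) (c : R) n : u j @[j --> \oo] --> c ->
    u j ^+ n @[j --> \oo] --> c ^+ n.
  move=> uc; elim: n => [|n IH]; first by under eq_fun do rewrite expr0; exact: cvg_cst.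
  by under eq_fun do rewrite exprS; rewrite exprS; exact: cvgM.
have r_cvg : (s j ^+ 2) ^+ D @[j --> \oo] --> (1 : R).
  by have := pow_cvg _ _ D (pow_cvg _ _ 2%N s_cvg); rewrite !expr1n.
have t_cvg : (s j ^+ 2) ^+ (M j).+1 @[j --> \oo] --> (0 : R).
  apply: (@squeeze_cvgr _ _ _ _ (fun=> 0) harmonic);
    [|exact: cvg_cst|exact: cvg_harmonic].
  apply: nearW => j; rewrite !exprn_ge0 //=.
  apply: le_trans (M0 j); rewrite -exprM; apply: ler_wiXn2l => //; [exact: ltW|lia].
have main_cvg : (s j ^+ 2) ^+ D * (1 - (s j ^+ 2) ^+ (M j).+1) ^+ N
    @[j --> \oo] --> (1 : R).
  rewrite -[1 in X in _ --> X]mulr1; apply: cvgM => //.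
  have := pow_cvg _ _ N (cvgB (cvg_cst (1 : R)) t_cvg).
  by rewrite subr0 expr1n; exact.
have err_cvg : radial_symbol N (s j ^+ 2) (M j) D -
    (s j ^+ 2) ^+ D * (1 - (s j ^+ 2) ^+ (M j).+1) ^+ N @[j --> \oo] --> (0 : R).
  apply/norm_cvg0P.
  apply: (@squeeze_cvgr _ _ _ _ (fun=> 0) harmonic);
    [|exact: cvg_cst|exact: cvg_harmonic].
  apply: nearW => j; rewrite normr_ge0 /=.
  exact: le_trans (radial_symbol_approx _ _ _ (s0 j) (s1 j)) (M1 j).
rewrite -[1 in X in _ --> X]add0r.
rewrite (_ : (fun j => _) = (fun j => (radial_symbol N (s j ^+ 2) (M j) D -
    (s j ^+ 2) ^+ D * (1 - (s j ^+ 2) ^+ (M j).+1) ^+ N) +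
    (s j ^+ 2) ^+ D * (1 - (s j ^+ 2) ^+ (M j).+1) ^+ N)).
  by apply: cvgD.
by apply/funext => j; rewrite subrK.
Qed.

Lemma cvg_real_complex (u : nat -> R) (l : R) : u j @[j --> \oo] --> l ->
  (fun j => (u j)%:C%C : R[i]^o) @ \oo --> (l%:C%C : R[i]^o).
Proof.
move=> /cvgrPdist_lt ul; apply/cvgrPdist_lt => e e0.
have eR : e = (complex.Re e)%:C%C by case: e e0 => a b /andP[/eqP /= -> _].
have e0' : 0 < complex.Re e by move: e0; rewrite eR ltcR.
apply: filterS (ul _ e0') => j uj.
by rewrite -rmorphB eR normc_def /= expr0n addr0 sqrtr_sqr ltcR.
Qed.

End Limit.

Theorem corollary4p7 (R : realType) (G : groupType) (N : nat)
    (X : 'I_N -> connected_graph) (act : G -> gprod X -> gprod X)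
    (G_countable : countable [set: G]%classic)
    (X_hyperbolic : forall i, hyperbolic R (X i))
    (X_degree : forall i, bounded_degree (X i))
    (act_action : group_action act)
    (act_isometric : isometric_action (@prod_dist N X) act)
    (act_proper : proper_action (@prod_dist N X) act) :
  weakly_amenable R G.
Proof.
have [x0] : inhabited (gprod X).
  have /(fun h i => cid (h i))/all_sig[x0 _] : forall i, exists x : X i, True.
    by move=> i; have [x] := vertex_nonempty (X i); exists x.
  exact: inhabits x0.
have [act1 actM] := act_action.
pose d i (g h : G) := gdist (act g x0 i) (act h x0 i).
have /choice[J JP] : forall i, exists J, four_point (X i) J.
  by move=> i; exact: hyperbolic_four_point (X_hyperbolic i).
pose hits i (e : bool) k l (g h : G) :=
  hit (x0 i) (J i) e k l (act g x0 i) (act h x0 i).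
have hits_count i M n g h : (n <= M)%N ->
    (\sum_(j : 'I_M.+1 * 'I_M.+1 * bool | (j.1.1 + j.1.2 == n :> nat)%N)
       hits i j.2 j.1.1 j.1.2 g h)%N = (d i g h <= n)%N.
  by move=> nM; exact: (hit_count (x0 i) (JP i) (act g x0 i) (act h x0 i) nM).
have /choice[K KP] : forall i, exists K : R, 0 <= K /\
    forall e m (al be : 'I_m -> R) (A B : R), 0 <= A -> 0 <= B ->
    \sum_k al k ^+ 2 <= A ^+ 2 -> \sum_l be l ^+ 2 <= B ^+ 2 ->
    schur_bound (fun g h => \sum_(k < m) \sum_(l < m)
      al k * be l * (hits i e k l g h)%:R) (A * (K * B)).
  move=> i; have [K K0 KP] := hit_schur_bound R (x0 i) (JP i) (X_degree i).
  by exists K; split => // e m; exact: KP.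
have K0 i : 0 <= K i by case: (KP i).
have hits_bound i := (KP i).2.
have [s [M [sM sym_cvg]]] := radial_symbol_cvg R N.
pose D g := prod_dist x0 (act g x0).
pose sym j := radial_symbol N (s j ^+ 2) (M j).
have DE g h : D (g^-1 * h)%g = (\sum_i d i g h)%N.
  rewrite /D -(act_isometric g) -actM mulgA mulgV mul1g //.
pose C := \prod_i (K i *+ 2) + \prod_i K i.
have C0 : 0 <= C.
  by apply: addr_ge0; apply: prodr_ge0 => i _; rewrite ?mulrn_wge0.
have symC j : schur_bound (fun g h => sym j (D (g^-1 * h)%g)) C.
  under eq_fun do under eq_fun do rewrite DE.
  have [s0 s1 sM1] := sM j.
  apply: schur_bound_le (radial_schur_bound K0 hits_count hits_bound (M j) s0 s1).
    rewrite addr_ge0 ?prodr_ge0 // => [i _|]; first by rewrite mulrn_wge0.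
    rewrite mulr_ge0 ?prodr_ge0 // mulr_ge0 ?exprn_ge0 // divr_ge0 //.
    by rewrite exprn_ge0 // subr_ge0 ltW.
  by rewrite lerD2l ler_piMr // prodr_ge0.
exists (fun j g => (sym j (D g))%:C%C); split.
- move=> j; apply: sub_finite_set (act_proper x0 (M j)) => g /=.
  move=> symN0; exists (act g x0); split.
    by exists x0 => //=; rewrite /prod_dist big1 // => i _; rewrite gdistxx.
  rewrite /= leqNgt; apply/negP => MD; case/eqP: symN0.
  by rewrite /sym radial_symbol_eq0.
- by move=> g; exact: cvg_real_complex (sym_cvg (D g)).
- by move=> j; have [] := schur_bound_cbnorm C0 (symC j).
apply: le_lt_trans (ltry C); apply: ub_ereal_sup => _ [j _ <-].
by have [] := schur_bound_cbnorm C0 (symC j).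
Qed.
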